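(* Let $t\ge 2$ and let $H=(V,E)$ be a finite $t$-uniform hypergraph with maximum degree at most $D$. For $S\subseteq V$ write $P(H[S],x)=\sum_i a_i(H[S])x^i$. Then $P$ is a monic hypergraph polynomial of exponential type, i.e. $P(\emptyset,x)=1$ and $\sum_{S\subseteq V}P(H[S],x)P(H[V\setminus S],y)=P(H,x+y)$, and moreover for every vertex $v\in V$ and every integer $s\ge 1$, $$\sum_{\substack{S\subseteq V,\ v\in S,\ |S|=s}}|a_1(H[S])|\le (etD)^{s-1}.$$ That is, $P$ is of bounded exponential type with $R(D,t)=etD$.
   Context: A hypergraph $H=(V,E)$ has a finite vertex set and a set of nonempty subsets of $V$ as edges; $t$-uniform means every edge has exactly $t$ vertices; the degree of a vertex is the number of edges containing it. $H[S]$ is the induced subhypergraph on $S$ (edges of $H$ contained in $S$). For a hypergraph $H$, $P(H,x)=P_H(x)$ is the polynomial with $P_H(q)$ equal to the number of colorings of the vertices with $q$ colors such that no edge is monochromatic; equivalently $P_H(x)=\sum_{E'\subseteq E}(-1)^{|E'|}x^{c(E')}$ with $c(E')$ the number of connected components of $(V,E')$ (a hypergraph $(V',E')$ is connected if for every partition of $V'$ into two nonempty parts some edge meets both parts). Thus $a_1(H)=\sum_{E'\subseteq E,\ (V,E')\text{ connected}}(-1)^{|E'|}$. Here $e$ is Euler's number. *)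

(* Defs.v *)
From mathcomp Require Import all_boot all_order all_algebra.

Set Implicit Arguments.
Unset Strict Implicit.
Unset Printing Implicit Defensive.

Import GRing.Theory.
Local Open Scope ring_scope.

(* The vertex set is an arbitrary finite set of elements of T, not all of T, so
   that a hypergraph and its induced subhypergraphs have the same type. *)
Record hypergraph (T : finType) := Hypergraph {
  vertices : {set T};
  edges : {set {set T}};
  edgesP : {in edges, forall e, e != set0 /\ e \subset vertices}
}.

Section Hypergraph.
Variable T : finType.
Implicit Types (H K : hypergraph T) (S A C e : {set T}) (F : {set {set T}}).

Definition uniform t H := {in edges H, forall e, #|e| = t}.

Definition degree H (v : T) : nat := #|[set e in edges H | v \in e]|.

Fact induced_subproof H S :
  {in [set e in edges H | e \subset S],
    forall e, e != set0 /\ e \subset vertices H :&: S}.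
Proof. by move=> e /[!inE] /andP[/edgesP[e0 eV] eS]; rewrite subsetI eV. Qed.

(* H[S]; when S is a set of vertices of H, its vertex set is S *)
Definition induced H S : hypergraph T := Hypergraph (@induced_subproof H S).

Fact spanning_subproof H F :
  {in edges H :&: F, forall e, e != set0 /\ e \subset vertices H}.
Proof. by move=> e /[!inE] /andP[/edgesP]. Qed.

(* (V, F); its edge set is F when F is a set of edges of H *)
Definition spanning H F : hypergraph T := Hypergraph (@spanning_subproof H F).

Definition connected H : bool :=
  [forall A : {set T},
    [&& A \subset vertices H, A != set0 & vertices H :\: A != set0] ==>
    [exists e in edges H,
      (e :&: A != set0) && (e :&: (vertices H :\: A) != set0)]].

Definition connected_set H S : bool :=
  [&& S \subset vertices H, S != set0 & connected (induced H S)].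

(* The hypergraph with no vertex satisfies [connected] but has no component. *)
Definition components H : {set {set T}} := [set C | maxset (connected_set H) C].

Definition hpoly H : {poly int} :=
  \sum_(F : {set {set T}} | F \subset edges H)
    (-1) ^+ #|F| *: 'X^#|components (spanning H F)|.

Definition coloring H (q : nat) := {ffun {x : T | x \in vertices H} -> 'I_q}.

Definition monochromatic H q (f : coloring H q) e : bool :=
  [exists c, [forall x, (val x \in e) ==> (f x == c)]].

Definition proper_coloring H q (f : coloring H q) : bool :=
  [forall e in edges H, ~~ monochromatic f e].

Lemma connectedP H S : S \subset vertices H -> reflect
  (forall A x y, x \in S -> y \in S -> x \in A -> y \notin A ->
     exists2 e, e \in edges H & e \subset S /\
       exists a b, [/\ a \in e, b \in e, a \in A & b \notin A])
  (connected (induced H S)).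
Proof.
move=> SV; have VS: vertices (induced H S) = S by apply/setIidPr.
apply: (iffP forallP) => [cS A x y xS yS xA yA | cS A].
  have /implyP := cS (S :&: A); rewrite VS subsetIl /= => /(_ _)/existsP[].
    apply/andP; split; apply/set0Pn; first by exists x; rewrite inE xS.
    by exists y; rewrite !inE yS (negPf yA).
  move=> e /and3P[] /[!inE] /andP[eE eS] /set0Pn[a] /[!inE] /and3P[ae aS aA].
  move=> /set0Pn[b] /[!inE] /and3P[be bA bS]; exists e => //; split=> //.
  by exists a, b; split=> //; apply: contra bA => ->; rewrite bS.
apply/implyP; rewrite VS => /and3P[AS /set0Pn[x xA] /set0Pn[y]].
rewrite inE => /andP[yA yS].
have [e eE [eS [a [b [ae be aA bA]]]]] := cS A x y (subsetP AS _ xA) yS xA yA.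
apply/existsP; exists e; rewrite !inE eE eS /=; apply/andP; split.
  by apply/set0Pn; exists a; rewrite inE ae.
by apply/set0Pn; exists b; rewrite !inE be bA (subsetP eS).
Qed.

Lemma conn1 H x : x \in vertices H -> connected_set H [set x].
Proof.
move=> xV; have xS: [set x] \subset vertices H by rewrite sub1set.
apply/and3P; split=> //; first by apply/set0Pn; exists x; rewrite inE.
by apply/connectedP=> // A y z /set1P-> /set1P-> ->.
Qed.

Lemma conn_edge H e : e \in edges H -> connected_set H e.
Proof.
move=> eE; have [e0 eV] := edgesP eE; rewrite /connected_set eV e0 /=.
by apply/connectedP=> // A x y xe ye xA yA; exists e => //; split=> //; exists x, y.
Qed.

Lemma connU H A B x :
  connected_set H A -> connected_set H B -> x \in A -> x \in B -> connected_set H (A :|: B).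
Proof.
move=> /and3P[AV A0 cA] /and3P[BV _ cB] xA xB.
have ABV: A :|: B \subset vertices H by rewrite subUset AV.
apply/and3P; split=> //; first by apply/set0Pn; exists x; rewrite inE xA.
have meet (D X : {set T}) y z : D \subset vertices H -> connected (induced H D) ->
    D \subset A :|: B -> y \in D -> z \in D -> (y \in X) != (z \in X) ->
    exists2 e, e \in edges H & e \subset A :|: B /\
       exists a b, [/\ a \in e, b \in e, a \in X & b \notin X].
  move=> DV /(connectedP DV) cD DAB yD zD yzX.
  have [yX | yX] := boolP (y \in X).
    have zX: z \notin X by move: yzX; rewrite yX; case: (z \in X).
    have [e eE [eD abP]] := cD X y z yD zD yX zX.
    by exists e; rewrite ?(subset_trans eD).
  have zX: z \in X by move: yzX; rewrite (negPf yX); case: (z \in X).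
  have [e eE [eD abP]] := cD X z y zD yD zX yX.
  by exists e; rewrite ?(subset_trans eD).
apply/connectedP=> // X y z yAB zAB yX zX.
have [yxX | yxX] := eqVneq (y \in X) (x \in X).
  have xzX: (x \in X) != (z \in X) by rewrite -yxX yX (negPf zX).
  by case/setUP: zAB => zD;
     [apply: meet xA zD xzX | apply: meet xB zD xzX]; rewrite ?subsetUl ?subsetUr.
by case/setUP: yAB => yD;
   [apply: meet yD xA yxX | apply: meet yD xB yxX]; rewrite ?subsetUl ?subsetUr.
Qed.

Lemma components_conn H C : C \in components H -> connected_set H C.
Proof. by rewrite inE => /maxsetp. Qed.

Lemma components_sup H S : connected_set H S -> exists2 C, C \in components H & S \subset C.
Proof. by case/maxset_exists=> C mC SC; exists C; rewrite // inE. Qed.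

Lemma components_eq H B C x :
  B \in components H -> C \in components H -> x \in B -> x \in C -> B = C.
Proof.
move=> Bc Cc xB xC; have cBC := connU (components_conn Bc) (components_conn Cc) xB xC.
move: Bc Cc; rewrite !inE => mB mC.
by rewrite -(maxsetsup mB cBC (subsetUl _ _)) (maxsetsup mC cBC (subsetUr _ _)).
Qed.

Lemma components_partition H : partition (components H) (vertices H).
Proof.
apply/and3P; split.
- rewrite eqEsubset; apply/andP; split; apply/subsetP=> x.
    by case/bigcupP=> C /components_conn/and3P[/subsetP CV _ _] /CV.
  move=> /conn1/components_sup[C Cc]; rewrite sub1set => xC.
  by apply/bigcupP; exists C.
- apply/trivIsetP=> B C Bc Cc; apply: contraR => /pred0Pn[x /andP[/= xB xC]].
  by apply/eqP/(components_eq Bc Cc xB xC).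
- by apply/negP=> /components_conn/and3P[_ /eqP].
Qed.

Lemma card_monochromatic H F q : F \subset edges H ->
  #|[set f : coloring H q | [forall e in F, monochromatic f e]]| =
  (q ^ #|components (spanning H F)|)%N.
Proof.
move=> FE; set K := spanning H F; set P := components K.
have KF: edges K = F by apply/setIidPr.
have /and3P[/eqP covP trivP P0] : partition P (vertices H) := components_partition K.
have blkP (x : {x | x \in vertices H}) : pblock P (val x) \in P.
  by rewrite pblock_mem // covP (valP x).
pose blk x : {C | C \in P} := exist _ (pblock P (val x)) (blkP x).
pose toV x (xV : x \in vertices H) : {x | x \in vertices H} := exist _ x xV.
pose G (g : {ffun {C | C \in P} -> 'I_q}) : coloring H q :=
  [ffun x => g (blk x)].
have <-: #|{ffun {C | C \in P} -> 'I_q}| = (q ^ #|P|)%N.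
  by rewrite card_ffun card_ord card_sig; congr (_ ^ _)%N; apply: eq_card.
have G_inj : injective G.
  move=> g h eqG; apply/ffunP=> C; have CP := valP C.
  have /and3P[CV /set0Pn[x xC] _] := components_conn CP.
  have xV: x \in vertices H := subsetP CV _ xC.
  have := congr1 (fun f : {ffun _ -> _} => f (toV x xV)) eqG; rewrite !ffunE.
  suff -> : blk (toV x xV) = C by [].
  by apply: val_inj; apply: def_pblock trivP CP xC.
rewrite -(card_imset _ G_inj); apply: eq_card => f; rewrite inE.
apply/idP/imsetP=> [/forallP fF | [g _ ->{f}]]; last first.
  apply/forallP=> e; apply/implyP; rewrite -KF => eK.
  have [C CP eC] := components_sup (conn_edge eK).
  apply/existsP; exists (g (exist _ C CP)); apply/forallP=> x.
  apply/implyP=> xe; rewrite ffunE; apply/eqP; congr (g _); apply: val_inj.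
  by apply: def_pblock trivP CP (subsetP eC _ xe).
have fC C (x y : {x | x \in vertices H}) :
    C \in P -> val x \in C -> val y \in C -> f x = f y.
  move=> /components_conn/and3P[CV _ /(connectedP CV) cC] xC yC.
  apply/eqP/idPn=> fxy; pose A := [set val z | z in [set z | f z == f x]].
  have memA z : (val z \in A) = (f z == f x) by rewrite mem_imset ?inE //; exact: val_inj.
  have xA: val x \in A by rewrite memA.
  have yA: val y \notin A by rewrite memA eq_sym.
  have [e + [eC [a [b [ae be aA bA]]]]] := cC A _ _ xC yC xA yA; rewrite KF => eF.
  have aV := subsetP CV _ (subsetP eC _ ae); have bV := subsetP CV _ (subsetP eC _ be).
  have /implyP/(_ eF)/existsP[c /forallP ec] := fF e.
  have /eqP fa := implyP (ec (toV a aV)) ae.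
  have /eqP fb := implyP (ec (toV b bV)) be.
  by move: aA bA; rewrite (memA (toV a aV)) (memA (toV b bV)) fa fb => ->.
have rep (C : {C | C \in P}) : {x : {x | x \in vertices H} | val x \in val C}.
  apply: sigW; have /and3P[CV /set0Pn[x xC] _] := components_conn (valP C).
  by exists (toV x (subsetP CV _ xC)).
exists [ffun C => f (sval (rep C))] => //; apply/ffunP=> x; rewrite !ffunE.
apply: (fC (pblock P (val x))) => //; last exact: (svalP (rep (blk x))).
by rewrite mem_pblock covP (valP x).
Qed.

Lemma sum_signs_subset (M : {set {set T}}) :
  \sum_(F : {set {set T}} | F \subset M) (-1) ^+ #|F| = (M == set0)%:R :> int.
Proof.
transitivity (\prod_(e : {set T}) ((if e \in M then -1 else 0) + 1 : int)).
  rewrite bigA_distr big_mkcond /=; apply: eq_bigr => F _.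
  rewrite -big_mkcond /=; case: ifPn => [FM | /subsetPn[e eF eM]].
    by rewrite (eq_bigr (fun=> -1)) ?prodr_const // => e /(subsetP FM) ->.
  by rewrite (bigD1 e) //= (negPf eM) mul0r.
have [-> | /set0Pn[e eM]] := eqVneq.
  by rewrite big1 // => e _; rewrite inE add0r.
by rewrite (bigD1 e) //= eM addNr mul0r.
Qed.

Theorem hpoly_colorings H q :
  (hpoly H).[q%:R] = #|[set f : coloring H q | proper_coloring f]|%:R.
Proof.
pose M (f : coloring H q) := [set e in edges H | monochromatic f e].
have MF f F : (F \subset M f) = (F \subset edges H) && [forall e in F, monochromatic f e].
  apply/subsetP/andP=> [FM | [/subsetP FE /forallP Ff] e eF].
    split; first by apply/subsetP=> e /FM /[!inE] /andP[].
    by apply/forallP=> e; apply/implyP=> /FM /[!inE] /andP[].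
  by rewrite inE FE //=; apply: implyP eF.
transitivity (\sum_(f : coloring H q)
    \sum_(F : {set {set T}} | F \subset M f) (-1) ^+ #|F| : int).
  rewrite horner_sum; under [RHS]eq_bigr do rewrite (eq_bigl _ _ (MF _)).
  rewrite (exchange_big_dep (fun F => F \subset edges H)) /=; last by move=> f F _ /andP[].
  apply: eq_bigr => F FE; rewrite hornerZ hornerXn -natrX -(card_monochromatic q FE).
  rewrite sumr_const -[RHS]mulr_natr; congr (_ * _%:R).
  by apply: eq_card => f; rewrite !inE unfold_in /= FE.
under eq_bigr do rewrite sum_signs_subset.
rewrite -sumr_const [RHS]big_mkcond /=; apply: eq_bigr => f _; rewrite inE.
have -> : (M f == set0) = proper_coloring f; last by case: ifP.
apply/eqP/forallP=> [M0 e | pf].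
  by apply/implyP=> eE; apply/negP=> fe; have := in_set0 e; rewrite -M0 inE eE fe.
by apply/setP=> e; rewrite !inE; apply/andP=> [[eE]]; apply/negP; apply: implyP eE.
Qed.

End Hypergraph.

(* Main.v *)
Require Import Defs.
From mathcomp Require Import all_boot all_order all_algebra.
From mathcomp Require Import reals sequences exp.
From mathcomp Require Import ring.

Set Implicit Arguments.
Unset Strict Implicit.
Unset Printing Implicit Defensive.

Import Order.TTheory GRing.Theory Num.Theory.
Local Open Scope ring_scope.

(* The coefficient a_1(H[S]) is the sum of (-1)^|F| over the edge sets F of H[S] joining every
   vertex of S to a root v. More generally, let C(Q, S) be the same sum with a set Q of roots.
   Deleting a root v together with the set F' of edges of F containing it turns the other
   vertices of F' into roots; grouping the F' by the set N of new roots, the cancellation in the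
   signed sum over the F' covering N leaves
     |C(Q, S)| <= sum_N (prod_(w in N) codeg(v, w)) |C((Q \ v) u N, S \ v)|.
   As the codegrees of v sum to at most d = tD, the sum of |C(Q, S)| over the S with |S \ Q| = s
   is at most d^s / s! times the number r (r + s)^(s - 1) of forests rooted at r = |Q| given
   vertices, which obeys the matching recursion by the binomial theorem. For r = 1 this is at
   most (e d)^s.
   The convolution identity holds term by term: the sets S such that every edge of F lies in S
   or in its complement are the unions of components of (V, F). *)

(** * Splitting sums over subsets *)

Section SubsetSums.
Variables (I : finType) (V : nmodType).

Lemma sum_subsetU (A B : {set I}) (G : {set I} -> V) : [disjoint A & B] ->
  \sum_(F : {set I} | F \subset A :|: B) G F =
  \sum_(F1 : {set I} | F1 \subset A) \sum_(F2 : {set I} | F2 \subset B) G (F1 :|: F2).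
Proof.
move=> dAB; have AB0 : A :&: B = set0 by apply/eqP; rewrite setI_eq0.
rewrite pair_big_dep /= (reindex_onto (fun p => p.1 :|: p.2)
  (fun F => (F :&: A, F :&: B))) /=; last first.
  by move=> F /setIidPl FAB; rewrite -setIUr.
apply: eq_bigl => -[F1 F2] /=; rewrite xpair_eqE.
apply/andP/andP => [[_ /andP[/eqP <- /eqP <-]] | [F1A F2B]].
  by rewrite !subsetIr.
split; first exact: setUSS.
rewrite !setIUl (setIidPl F1A) (setIidPl F2B).
have -> : F2 :&: A = set0.
  by apply/eqP; rewrite -subset0 -AB0 setIC setIS.
have -> : F1 :&: B = set0 by apply/eqP; rewrite -subset0 -AB0 setSI.
by rewrite setU0 set0U !eqxx.
Qed.

Lemma sum_subsetU1 (e : I) (M : {set I}) (G : {set I} -> V) : e \notin M ->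
  \sum_(F : {set I} | F \subset e |: M) G F =
  \sum_(F : {set I} | F \subset M) G F + \sum_(F : {set I} | F \subset M) G (e |: F).
Proof.
move=> eM; rewrite sum_subsetU ?disjoints1 // (bigD1 set0) ?sub0set //=.
congr (_ + _); first by apply: eq_bigr => F _; rewrite set0U.
rewrite (big_pred1 [set e]) // => F /=; rewrite subset1.
have [->|_] := eqVneq F set0; rewrite ?orbT ?orbF ?andbF ?andbT //.
by apply/esym/negbTE; rewrite eq_sym; apply/set0Pn; exists e; rewrite inE.
Qed.

End SubsetSums.

(** * Signed sums over covering families *)

Lemma coverU1 (T : finType) (e : {set T}) F : cover (e |: F) = e :|: cover F.
Proof. by rewrite /cover bigcup_setU big_set1. Qed.

Lemma finset_ind (T : finType) (P : {set T} -> Prop) :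
  P set0 -> (forall x (A : {set T}), x \notin A -> P A -> P (x |: A)) -> forall A, P A.
Proof.
move=> P0 PS A; have [n] := ubnP #|A|; elim: n A => // n IHn A.
have [->|/set0Pn[x xA]] := eqVneq A set0; first by [].
rewrite (cardsD1 x) xA add1n ltnS => An; rewrite -(setD1K xA).
by apply: PS; rewrite ?setD11 //; apply: IHn.
Qed.

(* Only the families covering [N] without redundancy in the order of insertion survive the
   cancellation; the first member containing each point of [N] determines such a family. *)
Lemma sum_signs_cover_le (R : realDomainType) (T : finType)
    (M : {set {set T}}) (N : {set T}) :
  `|\sum_(F : {set {set T}} | (F \subset M) && (N \subset cover F)) (-1) ^+ #|F| |
  <= (\prod_(w in N) #|[set e in M | w \in e]|)%:R :> R.
Proof.
elim/finset_ind: M N => [|e M eM IH] N.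
  have [->|/set0Pn[w wN]] := eqVneq N set0.
    rewrite big_set0 (big_pred1 set0) ?cards0 ?normr1 // => F.
    by rewrite sub0set andbT subset0.
  rewrite [X in `|X|]big_pred0 ?normr0 // => F; rewrite subset0; apply/andP => -[/eqP -> ].
  by rewrite /cover big_set0 => /subsetP /(_ w wN); rewrite inE.
have dS w : #|[set e' in e |: M | w \in e']| = (#|[set e' in M | w \in e']| + (w \in e))%N.
  have [we|we] := boolP (w \in e); last first.
    rewrite addn0; apply: eq_card => e' ; rewrite !inE.
    by case: eqVneq => [->|]; rewrite ?(negPf we) ?andbF.
  rewrite addn1 (_ : [set e' in e |: M | _] = e |: [set e' in M | w \in e']).
    by rewrite cardsU1 !inE (negPf eM).
  by apply/setP=> e'; rewrite !inE; case: eqVneq => [->|].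
(* The families are split by whether they contain [e]. Those that do carry the opposite sign, and
   their other members only have to cover [N :\: e]; if [e] misses [N], the two sums cancel. *)
rewrite big_mkcondr sum_subsetU1 //= -!big_mkcondr /=.
rewrite [X in _ + X](_ : _ = - \sum_(F : {set {set T}} |
    (F \subset M) && (N :\: e \subset cover F)) (-1) ^+ #|F|); last first.
  rewrite -sumrN; apply: eq_big => F; first by rewrite coverU1 subDset.
  case/andP=> FM _; rewrite cardsU1 (contra (subsetP FM e)) // exprD mulN1r //.
have [Ne|Ne] := eqVneq (N :&: e) set0.
  have -> : N :\: e = N by apply/setDidPl; rewrite -setI_eq0 Ne.
  by rewrite subrr normr0 ler0n.
apply: le_trans (ler_normB _ _) _.
apply: le_trans (lerD (IH _) (IH _)) _; rewrite -natrD ler_nat.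
(* Over [N :\: e] both products on the left have the same factors. What remains is that the product
   of the degrees over [N :&: e], plus 1, is at most the product of the degrees raised by 1;
   singling out one point [x] of [N :&: e] shows this. *)
rewrite !(big_setID e (A := N)) /= -[X in (_ + X <= _)%N]mul1n -mulnDl.
apply: leq_mul; last by apply: leq_prod => w _; rewrite dS leq_addr.
have /set0Pn[x xNe] := Ne.
rewrite !(big_setD1 x xNe) /= dS; have -> : x \in e by case/setIP: xNe.
rewrite mulnDl mul1n leq_add //.
  by rewrite leq_mul //; apply: leq_prod => w _; rewrite dS leq_addr.
rewrite prodn_cond_gt0 // => w /setD1P[_ /setIP[_ we]].
by rewrite dS we addn1.
Qed.

(** * Elementary symmetric sums and the count of rooted forests *)

(** The left side consists of the first two terms of the binomial expansion; the others are
    nonnegative. *)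
Lemma expr_bernoulli_le (R : realDomainType) (x y : R) n : 0 <= x -> 0 <= y ->
  x ^+ n.+1 + y * x ^+ n *+ n.+1 <= (x + y) ^+ n.+1.
Proof.
move=> x0 y0; rewrite exprDn 2!big_ord_recl subn0 expr0 mulr1 bin0 mulr1n.
rewrite /= /bump /= !add1n subSS subn0 expr1 bin1 [y * _]mulrC addrA lerDl.
by apply: sumr_ge0 => i _; rewrite mulrn_wge0 // mulr_ge0 ?exprn_ge0.
Qed.

(** The left side is the elementary symmetric polynomial e_k of the weights. Adding a point [w] to
    [U] turns e_(k+1) into e_(k+1) + m(w) e_k, and [expr_bernoulli_le] absorbs the new term. *)
Lemma sum_prod_subsets_le (R : realFieldType) (T : finType) (m : T -> R)
    (U : {set T}) k : (forall w, 0 <= m w) ->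
  \sum_(N : {set T} | (N \subset U) && (#|N| == k)) \prod_(w in N) m w
  <= (\sum_(w in U) m w) ^+ k / k`!%:R.
Proof.
move=> m0; elim/finset_ind: U k => [|w U wU IH] k.
  rewrite big_set0; case: k => [|k].
    rewrite expr0 divr1 (big_pred1 set0) ?big_set0 // => N.
    by rewrite subset0 cards_eq0 andbb.
  rewrite [X in X <= _]big_pred0 ?divr_ge0 ?exprn_ge0 // => N.
  by rewrite subset0; case: eqVneq => [->|]; rewrite ?cards0.
case: k => [|k].
  rewrite expr0 divr1 (big_pred1 set0) ?big_set0 // => N.
  by rewrite cards_eq0 /=; case: eqVneq => [->|_]; rewrite ?sub0set ?andbF.
rewrite big_mkcondr sum_subsetU1 // -!big_mkcondr /= big_setU1 //=.
rewrite [X in _ + X <= _](_ : _ = m w *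
    \sum_(N : {set T} | (N \subset U) && (#|N| == k)) \prod_(z in N) m z); last first.
  have wN (N : {set T}) : N \subset U -> w \notin N by move=> NU; apply: contra (subsetP NU w) wU.
  rewrite mulr_sumr; apply: eq_big => [N | N /andP[/wN wN' _]]; last by rewrite big_setU1.
  by case: (boolP (_ \subset _)) => // /wN wN'; rewrite cardsU1 wN' add1n eqSS.
apply: le_trans (lerD (IH k.+1) (ler_wpM2l (m0 w) (IH k))) _.
set x := \sum_(_ in U) _; have x0 : 0 <= x by apply: sumr_ge0.
have k0 : k.+1`!%:R != 0 :> R by rewrite pnatr_eq0 -lt0n fact_gt0.
rewrite [m w + x]addrC; apply: le_trans (ler_wpM2r _ (expr_bernoulli_le k x0 (m0 w))); last first.
  by rewrite invr_ge0 ler0n.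
rewrite le_eqVlt; apply/orP; left; apply/eqP.
move: k0; rewrite factS natrM mulf_eq0 negb_or => /andP[k0 kf0].
by rewrite -mulr_natr; field; rewrite ?nat1r k0 kf0.
Qed.

(* The number of rooted forests on [r + s] labelled vertices with [r] given roots. *)
Definition forest_bound r s := if s is s'.+1 then (r * (r + s) ^ s')%N else 1%N.

(** Since k C(s+1, k) = (s+1) C(s, k-1), this is the binomial theorem for (N + 1)^s. *)
Lemma sum_bin_mul_exp N s :
  (\sum_(k < s.+2) 'C(s.+1, k) * (k * N ^ (s.+1 - k)) = s.+1 * N.+1 ^ s)%N.
Proof.
rewrite big_ord_recl /= mul0n muln0 add0n -[N.+1]addn1 expnDn big_distrr /=.
apply: eq_bigr => k _; rewrite /bump /= add1n subSS exp1n muln1 !mulnA.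
by rewrite [('C(_, _) * _)%N]mulnC -mul_bin_diag.
Qed.

(** Deleting one of r + 1 roots turns its k children, chosen among the s other vertices, into roots
    beside the remaining r. The proof is by algebra. *)
Lemma forest_boundS r s :
  (\sum_(k < s.+1) 'C(s, k) * forest_bound (r + k) (s - k) = forest_bound r.+1 s)%N.
Proof.
case: s => [|s]; first by rewrite big_ord1 bin0.
set N := (r + s.+1)%N; have N0 : (0 < N)%N by rewrite /N addnS.
(* After multiplication by N the k-th forest count becomes (r + k) N^(s+1-k) for every k, including
   k = s + 1, where [forest_bound] takes its separate value 1 and r + k = N. *)
apply/eqP; rewrite -(eqn_pmul2l N0) big_distrr /=; apply/eqP.
transitivity (\sum_(k < s.+2) ('C(s.+1, k) * (r * N ^ (s.+1 - k)) +
    'C(s.+1, k) * (k * N ^ (s.+1 - k))))%N.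
  apply: eq_bigr => k _; rewrite -mulnDr -mulnDl mulnCA; congr (_ * _)%N.
  have ks : (k <= s.+1)%N by rewrite -ltnS.
  rewrite /forest_bound; case Es: (s.+1 - k)%N => [|j].
    by rewrite muln1 expn0 muln1 /N; congr (_ + _)%N; move: (subnKC ks); rewrite Es addn0.
  by rewrite -Es -addnA subnKC // -/N Es expnS mulnCA.
rewrite big_split /= sum_bin_mul_exp.
rewrite [X in (X + _)%N](_ : _ = r * N.+1 ^ s.+1)%N; last first.
  rewrite -[N.+1]addn1 expnDn big_distrr /=; apply: eq_bigr => k _.
  by rewrite exp1n muln1 mulnCA.
rewrite addSn -/N expnS mulnA -mulnDl [RHS]mulnA; congr (_ * _)%N.
by rewrite !mulnS addnAC [(N * r)%N]mulnC.
Qed.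

(** By induction: passing from (n+2)^n to (n+3)^(n+1) costs the factor n + 2, matched by the
    factorial, and (1 + 1/(n+2))^(n+1), which is at most e because 1 + x <= exp x. *)
Lemma forest_bound1_le (R : realType) s :
  (forest_bound 1 s)%:R / s`!%:R <= expR 1 ^+ s :> R.
Proof.
case: s => [|n]; first by rewrite divr1 expr0.
rewrite /= mul1n add1n ler_pdivrMr ?ltr0n ?fact_gt0 // natrX.
elim: n => [|n IH].
  by rewrite expr0 expr1 mulr1 ltW // expR_gt1.
have n2 : n.+2%:R != 0 :> R by rewrite pnatr_eq0.
have e0 : 0 <= expR 1 :> R := expR_ge0 1.
have step : (n.+3%:R / n.+2%:R) ^+ n.+1 <= expR 1 :> R.
  have le1 : n.+3%:R / n.+2%:R <= expR (n.+2%:R^-1) :> R.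
    rewrite (le_trans _ (expR_ge1Dx _)) // -[n.+3]add1n natrD mulrDl mul1r.
    by rewrite mulfV // addrC.
  apply: le_trans (lerXn2r _ _ _ le1) _; rewrite ?nnegrE ?divr_ge0 ?expR_ge0 //.
  by rewrite -expRM_natl ler_expR ler_pdivrMr ?ltr0n // mul1r ler_nat.
have -> : n.+3%:R ^+ n.+1 = (n.+3%:R / n.+2%:R) ^+ n.+1 * (n.+2%:R * n.+2%:R ^+ n) :> R.
  by rewrite -exprS -exprMn divfK.
apply: le_trans (ler_pM _ _ step (ler_wpM2l _ IH)) _; rewrite ?mulr_ge0 ?exprn_ge0 ?divr_ge0 //.
rewrite [n.+2`!]factS natrM ![expR 1 ^+ _.+1]exprS.
by rewrite le_eqVlt; apply/orP; left; apply/eqP; ring.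
Qed.

(** * Rooted sums and the deletion of a root *)

Section RootedSum.
Variables (R : realFieldType) (T : finType) (E : {set {set T}}).
Implicit Types (A N Q S U : {set T}) (F : {set {set T}}).

Definition edges_in S := [set e in E | e \subset S].

(* Every vertex of [S] is joined to a vertex of [Q] by edges of [F]. *)
Definition rooted F Q S := [forall A : {set T}, (Q \subset A) && (A \proper S) ==>
  [exists e in F, (e :&: A != set0) && (e :&: (S :\: A) != set0)]].

(** This is the quantity C(Q, S) of the overview. *)
Definition rooted_sum Q S : R :=
  \sum_(F : {set {set T}} | (F \subset edges_in S) && rooted F Q S) (-1) ^+ #|F|.

Definition codegree v w := #|[set e in E | (v \in e) && (w \in e)]|.

Lemma rootedP F Q S : reflect
  (forall A, Q \subset A -> A \proper S ->
     exists2 e, e \in F & exists a b, [/\ a \in e, b \in e, a \in A & b \in S :\: A])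
  (rooted F Q S).
Proof.
apply: (iffP forallP) => [rF A QA AS | rF A].
  have /implyP/(_ _)/existsP[|e] := rF A; first by rewrite QA.
  case/and3P => eF /set0Pn[a /setIP[ae aA]] /set0Pn[b /setIP[be bA]].
  by exists e => //; exists a, b.
apply/implyP => /andP[QA AS]; have [e eF [a [b [ae be aA bA]]]] := rF A QA AS.
apply/existsP; exists e; rewrite eF /=; apply/andP; split; apply/set0Pn.
  by exists a; rewrite inE ae.
by exists b; rewrite inE be.
Qed.

(** A set [A] to be left by an edge in [S :\ v] corresponds to [v |: A] in [S]. No edge of [F1]
    leaves [v |: A] once [A] contains the new roots. Conversely, if an edge of [F1] leaves a set
    containing [v], it already crosses; otherwise that set contains [cover F1], and an edge of [F2]
    is found after removing [v]. *)
Lemma rooted_delete_root v F1 F2 Q S : v \in Q -> Q \subset S ->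
    {in F1, forall e : {set T}, v \in e /\ e \subset S} ->
    {in F2, forall e : {set T}, v \notin e} ->
  rooted (F1 :|: F2) Q S = rooted F2 ((Q :|: cover F1) :\ v) (S :\ v).
Proof.
move=> vQ QS F1v F2v; have vS : v \in S := subsetP QS v vQ.
apply/rootedP/rootedP => rF A QA AS.
  have QvA : Q :|: cover F1 \subset v |: A by rewrite -subDset.
  have /properP[/subsetP AS' [x /setD1P[xv xS] xA]] := AS.
  have vAS : v |: A \proper S.
    apply/properP; split; last by exists x; rewrite // !inE negb_or xv.
    by apply/subsetP => y /setU1P[-> // | /AS' /setD1P[]].
  have [|e eF [a [b [ae be aA bA]]]] := rF (v |: A) _ vAS.
    by apply: subset_trans QvA; apply: subsetUl.
  case/setUP: eF => eF.
    have /subsetP eA : e \subset v |: A.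
      by apply: subset_trans QvA; apply/subsetU/orP; right; apply: bigcup_sup.
    by move: bA; rewrite inE (eA b be).
  have ve := F2v e eF; exists e => //; exists a, b; split => //.
    by case/setU1P: aA => // av; rewrite -av ae in ve.
  by move: bA; rewrite !inE negb_or => /andP[/andP[-> ->] ->].
have vA : v \in A by apply: subsetP vQ.
have [[e eF1 eA] | F1A] : {e | e \in F1 & ~~ (e \subset A)} + (cover F1 \subset A).
- case: (pickP [pred e in F1 | ~~ (e \subset A)]) => [e /andP[]|noe]; first by left; exists e.
  by right; apply/bigcupsP => e eF1; have := noe e; rewrite /= eF1 => /negbFE.
- have [ve /subsetP eS] := F1v e eF1; have /subsetPn[b be bA] := eA.
  by exists e; [rewrite inE eF1 | exists v, b; rewrite !inE bA eS].
have [||e eF2 [a [b [ae be aA bA]]]] := rF (A :\ v).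
- by rewrite setSD // subUset QA.
- have /properP[AS' [x xS xA]] := AS; apply/properP; split; first exact: setSD.
  exists x; last by rewrite !inE (negPf xA) andbF.
  by rewrite !inE xS andbT; apply: contraNneq xA => ->.
exists e; first by rewrite inE eF2 orbT.
exists a, b; split => //; first by case/setD1P: aA.
by move: bA; rewrite !inE; case: eqVneq => //= _ /andP[-> ->].
Qed.

(** The edges inside [S] are those through [v] and those inside [S :\ v]; a set of edges splits
    accordingly and its sign is multiplicative. *)
Lemma rooted_sum_delete_root v Q S : v \in Q -> Q \subset S ->
  rooted_sum Q S = \sum_(F : {set {set T}} | F \subset [set e in edges_in S | v \in e])
    (-1) ^+ #|F| * rooted_sum ((Q :|: cover F) :\ v) (S :\ v).
Proof.
move=> vQ QS; rewrite /rooted_sum big_mkcondr; set M := [set e in edges_in S | v \in e].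
have -> : edges_in S = M :|: edges_in (S :\ v).
  apply/setP => e; rewrite !inE subsetD1; case: (e \in E) => //=.
  by case: (e \subset S) => //=; case: (v \in e).
have dis : [disjoint M & edges_in (S :\ v)].
  rewrite -setI_eq0; apply/eqP/setP => e; rewrite !inE subsetD1.
  by case: (v \in e); rewrite ?andbF.
rewrite sum_subsetU //.
apply: eq_bigr => F1 /subsetP F1E; rewrite mulr_sumr [RHS]big_mkcondr /=.
apply: eq_bigr => F2 F2E.
have F1v : {in F1, forall e : {set T}, v \in e /\ e \subset S}.
  by move=> e /F1E; rewrite !inE => /andP[/andP[_ ->] ->].
have F2v : {in F2, forall e : {set T}, v \notin e}.
  by move=> e /(subsetP F2E); rewrite inE subsetD1 => /and3P[].
rewrite (rooted_delete_root vQ QS F1v F2v); case: ifP => // _.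
rewrite -exprD -cardsUI (_ : F1 :&: F2 = set0) ?cards0 ?addn0 //.
by apply/setP => e; rewrite !inE; apply/andP => -[/F1v[ve _] /F2v]; rewrite ve.
Qed.

Lemma norm_rooted_sum_le v Q S : v \in Q -> Q \subset S ->
  `|rooted_sum Q S| <= \sum_(N : {set T} | N \subset S :\: Q)
    (\prod_(w in N) (codegree v w)%:R) * `|rooted_sum ((Q :\ v) :|: N) (S :\ v)|.
Proof.
move=> vQ QS; rewrite (rooted_sum_delete_root vQ QS).
set M := [set e in _ | _].
(* The set of new roots [N] determines the rooted sum left after the deletion, so only a sum of
   signs over the families producing [N] has to be bounded. *)
rewrite (partition_big (fun F => cover F :\: Q) (fun N => N \subset S :\: Q)) /=; last first.
  move=> F /subsetP FM; apply/setSD/bigcupsP => e /FM; rewrite !inE.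
  by case/andP => /andP[].
apply: le_trans (ler_norm_sum _ _ _) _; apply: ler_sum => N NSQ.
have QN : [disjoint N & Q] by move: NSQ; rewrite subsetD => /andP[].
rewrite (eq_bigr (fun F => (-1) ^+ #|F| * rooted_sum ((Q :\ v) :|: N) (S :\ v))); last first.
  move=> F /andP[_ /eqP <-]; congr (_ * rooted_sum _ _); apply/setP => x; rewrite !inE.
  by case: eqVneq => [->|_]; rewrite /= ?vQ //; case: (x \in Q).
rewrite -mulr_suml normrM ler_wpM2r //.
(* Having [N] as set of new roots is a condition on each edge separately together with the covering
   of [N], the form required by [sum_signs_cover_le]. *)
rewrite (eq_bigl (fun F => (F \subset [set e in M | e :\: Q \subset N]) && (N \subset cover F))).
  apply: le_trans (sum_signs_cover_le _ _ _) _; rewrite natr_prod.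
  apply: ler_prod => w _; rewrite ler0n ler_nat subset_leq_card //.
  by apply/subsetP => e; rewrite !inE => /andP[/andP[/andP[/andP[-> _] ->] _] ->].
move=> F; rewrite eqEsubset subsetD QN andbT andbA; congr (_ && _).
apply/andP/subsetP => [[/subsetP FM FN] e eF | FN].
  by rewrite inE FM //=; apply: subset_trans FN; apply/setSD/bigcup_sup.
split; first by apply/subsetP => e /FN; rewrite inE => /andP[].
apply/subsetP => x /setDP[/bigcupP[e eF xe] xQ].
by have := FN e eF; rewrite inE => /andP[_ /subsetP]; apply; rewrite inE xQ.
Qed.

Definition level_sum U Q s : R :=
  \sum_(S : {set T} | [&& Q \subset S, S \subset U & #|S| == (#|Q| + s)%N])
    `|rooted_sum Q S|.

Lemma level_sum_delete_root_le U v Q s : v \in Q ->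
  level_sum U Q s <= \sum_(N : {set T} | (N \subset U :\: Q) && (#|N| <= s)%N)
    (\prod_(w in N) (codegree v w)%:R) * level_sum U ((Q :\ v) :|: N) (s - #|N|).
Proof.
move=> vQ.
have step S : [&& Q \subset S, S \subset U & #|S| == (#|Q| + s)%N] ->
    `|rooted_sum Q S| <= \sum_(N : {set T} | N \subset S :\: Q)
      (\prod_(w in N) (codegree v w)%:R) * `|rooted_sum ((Q :\ v) :|: N) (S :\ v)|.
  by case/and3P => QS _ _; apply: norm_rooted_sum_le.
apply: le_trans (ler_sum _ step) _.
rewrite (exchange_big_dep (fun N => (N \subset U :\: Q) && (#|N| <= s)%N)) /=; last first.
  move=> S N /and3P[QS SU /eqP cS] NSQ; rewrite (subset_trans NSQ) ?setSD //=.
  apply: leq_trans (subset_leq_card NSQ) _.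
  by rewrite cardsD (setIidPr QS) cS addKn.
apply: ler_sum => N /andP[NU Ns]; rewrite -mulr_sumr ler_wpM2l //.
  by apply: prodr_ge0.
(* The sum now runs over [S' = S :\ v]. The points of [N] pass from non-roots to roots, which leaves
   [s - #|N|] non-roots; as the terms are nonnegative, it is enough to include one index set in the
   other. *)
rewrite (reindex_onto (fun S' => v |: S') (fun S => S :\ v)) /=; last first.
  by move=> S /andP[/and3P[/subsetP/(_ v vQ) vS _ _] _]; rewrite setD1K.
rewrite [X in X <= _](eq_bigr (fun S' => `|rooted_sum (Q :\ v :|: N) S'|)); last first.
  by move=> S' /andP[_ /eqP ->].
rewrite /level_sum big_mkcond [leRHS]big_mkcond; apply: ler_sum => S' _.
case: ifP => [|_]; last by case: ifP.
case/andP => /andP[/and3P[QS SU /eqP cS] NSQ] /eqP S'v.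
have vS' : v \notin S' by rewrite -S'v setD11.
have vN : v \notin N by apply/negP => /(subsetP NSQ); rewrite inE vQ.
have QN : [disjoint N & Q] by move: NSQ; rewrite subsetD => /andP[].
rewrite ifT //; apply/and3P; split.
- rewrite subUset; apply/andP; split; first by rewrite subDset.
  by rewrite -S'v subsetD1 vN andbT; apply: subset_trans NSQ (subsetDl _ _).
- by apply: subset_trans SU; apply: subsetUr.
have cQN : #|Q :\ v :|: N| = (#|Q :\ v| + #|N|)%N.
  apply/eqP; rewrite (leq_card_setU _ _).2 disjoint_sym.
  by apply: disjointWr QN; apply: subsetDl.
move: cS; rewrite cQN cardsU1 vS' (cardsD1 v Q) vQ -!addnA subnKC // => /eqP.
by rewrite eqn_add2l.
Qed.

(** Induction on [#|Q| + s], the size of the sets [S]: deleting a root lowers it by one, and the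
    bound obeys the recursion [forest_boundS]. *)
Lemma level_sum_le U (d : R) Q s : 0 <= d ->
    {in U, forall v, \sum_(w in U :\ v) (codegree v w)%:R <= d} -> Q \subset U ->
  level_sum U Q s <= d ^+ s * (forest_bound #|Q| s)%:R / s`!%:R.
Proof.
move=> d0 Ud; have [n] := ubnP (#|Q| + s); elim: n Q s => // n IHn Q s.
have [->|/set0Pn[v vQ]] := eqVneq Q set0.
  rewrite cards0 add0n => _ _; case: s => [|s].
    rewrite expr0 mul1r divr1 /level_sum (big_pred1 set0); last first.
      by move=> S; rewrite sub0set cards0 cards_eq0 /=; case: eqVneq => [->|_];
        rewrite ?sub0set ?andbF.
    (* Every [F] is rooted when [S] is empty. Since [E] is arbitrary and may contain the empty set,
       the sum of signs is only bounded by the empty product 1. *)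
    rewrite /rooted_sum (eq_bigl (fun F : {set {set T}} =>
      (F \subset edges_in set0) && (set0 \subset cover F))).
      by apply: le_trans (sum_signs_cover_le _ _ _) _; rewrite big_set0.
    move=> F; rewrite sub0set; congr (_ && _); apply/rootedP => A _.
    by rewrite properE sub0set andbF.
  rewrite /level_sum big1 ?mulr_ge0 ?invr_ge0 ?exprn_ge0 // => S.
  rewrite cards0 add0n => /and3P[_ _ /eqP cS]; rewrite /rooted_sum big_pred0 ?normr0 // => F.
  apply/negbTE/nandP; right; apply/negP => /rootedP/(_ set0)[] //.
    by rewrite proper0 -cards_eq0 cS.
  by move=> e _ [a [b []]]; rewrite inE.
move=> Qs QU; apply: le_trans (level_sum_delete_root_le U s vQ) _.
have vU : v \in U := subsetP QU v vQ.
set r := #|Q :\ v|; have rQ : #|Q| = r.+1 by rewrite (cardsD1 v) vQ.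
(* This is the induction hypothesis for [k] new roots; it depends on [N] only through its size, so
   the sum is grouped by [#|N|]. *)
pose c k : R := d ^+ (s - k) * (forest_bound (r + k) (s - k))%:R / (s - k)`!%:R.
have c0 k : 0 <= c k by rewrite /c divr_ge0 ?mulr_ge0 ?exprn_ge0.
have step N : (N \subset U :\: Q) && (#|N| <= s)%N ->
    (\prod_(w in N) (codegree v w)%:R) * level_sum U ((Q :\ v) :|: N) (s - #|N|) <=
    (\prod_(w in N) (codegree v w)%:R) * c #|N|.
  rewrite subsetD => /andP[/andP[NU NQ] Ns].
  have cQN : #|Q :\ v :|: N| = (r + #|N|)%N.
    apply/eqP; rewrite (leq_card_setU _ _).2 disjoint_sym.
    by apply: disjointWr NQ; apply: subsetDl.
  apply: ler_wpM2l; first exact: prodr_ge0.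
  rewrite /c -cQN; apply: IHn.
    by rewrite cQN -addnA subnKC // -ltnS -addSn -rQ.
  by rewrite subUset NU andbT; apply: subset_trans QU; apply: subsetDl.
apply: le_trans (ler_sum _ step) _.
rewrite (partition_big (fun N => inord #|N| : 'I_s.+1) xpredT) //=.
have termle (k : 'I_s.+1) : true ->
    \sum_(N : {set T} | ((N \subset U :\: Q) && (#|N| <= s)%N) && (inord #|N| == k))
      (\prod_(w in N) (codegree v w)%:R) * c #|N| <= d ^+ k / k`!%:R * c k.
  move=> _; rewrite (eq_big (fun N : {set T} => (N \subset U :\: Q) && (#|N| == k))
    (fun N => (\prod_(w in N) (codegree v w)%:R) * c k)); last first.
  - by move=> N /andP[/andP[_ Ns] /eqP <-]; rewrite inordK.
  - move=> N; rewrite -andbA; congr (_ && _); apply/andP/eqP => [[Ns /eqP <-]| ck].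
      by rewrite inordK.
    by rewrite ck -ltnS ltn_ord; split => //; apply/eqP/val_inj; rewrite /= inordK.
  rewrite -mulr_suml ler_wpM2r //.
  apply: le_trans (sum_prod_subsets_le _ _ _) _ => //.
  rewrite ler_wpM2r ?invr_ge0 // lerXn2r ?nnegrE ?sumr_ge0 //.
  (* As [v] is a root, [U :\: Q] lies in [U :\ v], whose codegrees sum to at most [d]. *)
  apply: le_trans (Ud v vU); rewrite [leRHS](big_setID (U :\: Q)) /=.
  rewrite (_ : (U :\ v) :&: (U :\: Q) = U :\: Q) ?lerDl ?sumr_ge0 //.
  by apply/setIidPr/subsetP => x; rewrite !inE => /andP[xQ ->]; rewrite andbT;
     apply: contraNneq xQ => ->.
apply: le_trans (ler_sum _ termle) _.
(* The two sides now agree term by term, since 1 / (k! (s-k)!) = C(s, k) / s!. *)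
rewrite rQ -forest_boundS natr_sum mulr_sumr mulr_suml; apply: ler_sum => k _.
have ks : (k <= s)%N by rewrite -ltnS.
rewrite le_eqVlt; apply/orP; left; apply/eqP.
rewrite -[in RHS](bin_fact ks) /c -[in d ^+ s](subnKC ks) exprD !natrM.
have f0 j : j`!%:R != 0 :> R by rewrite pnatr_eq0 -lt0n fact_gt0.
have b0 : 'C(s, k)%:R != 0 :> R by rewrite pnatr_eq0 -lt0n bin_gt0.
by field; rewrite !f0 b0.
Qed.

End RootedSum.

(** * Codegree sums and the binomial theorem over subsets *)

(** Double counting: each edge through [v] is counted once for each of its points in [A], at most
    [t] times. *)
Lemma sum_codegree_le (T : finType) (E : {set {set T}}) (A : {set T}) v t :
    {in E, forall e : {set T}, #|e| = t} ->
  (\sum_(w in A) codegree E v w <= t * #|[set e in E | v \in e]|)%N.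
Proof.
move=> Et.
have cE w : codegree E v w = (\sum_(e in E | v \in e) (w \in e))%N.
  rewrite -[codegree _ _ _]sum1_card big_mkcond [RHS]big_mkcond; apply: eq_bigr => e _.
  by rewrite inE andbA; case: ((e \in E) && _) => //=; case: (w \in e).
under eq_bigr do rewrite cE.
rewrite exchange_big /= mulnC -sum_nat_const.
rewrite [leqRHS](eq_bigl (fun e => (e \in E) && (v \in e))) => [|e]; last by rewrite inE.
apply: leq_sum => e /andP[eE _]; rewrite -(Et e eE) -[leqRHS]sum1_card.
rewrite [leqRHS]big_mkcond [leqLHS]big_mkcond; apply: leq_sum => w _.
by case: ifP; case: (w \in e).
Qed.

Lemma sum_subsets_exp (R : comPzRingType) (I : finType) (x y : R) (P : {set I}) :
  \sum_(J : {set I} | J \subset P) x ^+ #|J| * y ^+ (#|P| - #|J|) = (x + y) ^+ #|P|.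
Proof.
elim/finset_ind: P => [|i P iP IH].
  rewrite (big_pred1 set0) => [|J]; last by rewrite subset0.
  by rewrite cards0 !expr0 mulr1.
rewrite sum_subsetU1 // cardsU1 iP add1n exprS mulrDl addrC -IH !mulr_sumr.
congr (_ + _); apply: eq_bigr => J JP.
  have iJ : i \notin J by apply: contra iP; apply: subsetP.
  by rewrite cardsU1 iJ add1n subSS exprS mulrA.
by rewrite subSn ?subset_leq_card // exprS mulrCA.
Qed.

(** * Components, the convolution identity and the coefficients of the polynomial *)

Section Components.
Variable T : finType.
Implicit Types (H K : hypergraph T) (C S : {set T}) (F : {set {set T}}).

Lemma eq_connected H K :
  vertices H = vertices K -> edges H = edges K -> connected H = connected K.
Proof. by rewrite /connected => -> ->. Qed.

Lemma edges_sub_vertices H : edges H = [set e in edges H | e \subset vertices H].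
Proof.
by apply/setP => e; rewrite inE; apply/idP/andP => [eH | []//]; have [_] := edgesP eH.
Qed.

Lemma connected_set_vertices H :
  connected_set H (vertices H) = (vertices H != set0) && connected H.
Proof.
rewrite /connected_set subxx /=; congr (_ && _); apply: eq_connected => /=.
  exact: setIid.
by rewrite -edges_sub_vertices.
Qed.

(** Nonemptiness is stated separately because [connected] also holds for the hypergraph with no
    vertex. *)
Lemma card_components_eq1 H :
  (#|components H| == 1%N) = (vertices H != set0) && connected H.
Proof.
have /and3P[/eqP covH _ _] := components_partition H.
rewrite -connected_set_vertices; apply/cards1P/idP => [[C defC] | cH].
  have CH : C \in components H by rewrite defC set11.
  have -> : vertices H = C by rewrite -covH defC /cover big_set1.
  exact: components_conn.
have [C CH VC] := components_sup cH.
have /and3P[CV _ _] := components_conn CH.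
have {VC CV} defC : C = vertices H by apply/eqP; rewrite eqEsubset CV.
exists C; apply/setP => B; rewrite inE; apply/idP/eqP => [BH | -> //].
have /and3P[BV /set0Pn[x xB] _] := components_conn BH.
by apply: (components_eq BH CH xB); rewrite defC (subsetP BV).
Qed.

Lemma connected_rooted H v : v \in vertices H ->
  connected H = rooted (edges H) [set v] (vertices H).
Proof.
move=> vH; apply/forallP/forallP => cH A; apply/implyP; last first.
  case/and3P => AV A0 VA0; have [vA | vA] := boolP (v \in A).
    by apply: (implyP (cH A)); rewrite sub1set vA properE AV -setD_eq0.
  (* Crossing is symmetric in the two sides, so a set missing [v] is replaced by its complement. *)
  have /implyP/(_ _)/existsP[] := cH (vertices H :\: A).
    by rewrite sub1set inE vA vH properE subsetDl -setD_eq0 setDDr setDv set0U (setIidPr AV).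
  move=> e; rewrite setDDr setDv set0U (setIidPr AV) => /and3P[eH eVA eA].
  by apply/existsP; exists e; rewrite eH eA.
rewrite sub1set => /andP[vA AV]; apply: (implyP (cH A)).
rewrite (proper_sub AV) setD_eq0 (proper_subn AV) andbT /=.
by apply/set0Pn; exists v.
Qed.

Lemma card_components_lt H e : e \in edges H -> (1 < #|e|)%N ->
  (#|components H| < #|vertices H|)%N.
Proof.
move=> eH e1; have [C CH eC] := components_sup (conn_edge eH).
rewrite (card_partition (components_partition H)) -sum1_card !(bigD1 C CH) /= -addSn.
apply: leq_add; first exact: leq_trans e1 (subset_leq_card eC).
apply: leq_sum => B /andP[BH _].
by case/components_conn/and3P: BH => _; rewrite card_gt0.
Qed.

Lemma card_components_spanning0 H : #|components (spanning H set0)| = #|vertices H|.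
Proof.
(* With no edge all 2-colorings are counted by [card_monochromatic], and the exponents of 2 are
   compared. *)
apply: (@expnI 2) => //; rewrite -card_monochromatic ?sub0set //.
rewrite (_ : [set f | _] = setT) ?cardsT ?card_ffun ?card_ord ?card_sig; last first.
  by apply/setP => f; rewrite !inE; apply/forallP => e; rewrite inE.
by [].
Qed.

(** For a set [F] of edges of [H], this says that [F] is made of an edge set of H[S] and one of the
    subhypergraph induced on the complement. *)
Definition splits H F S :=
  [forall e in F, (e \subset S) || (e \subset vertices H :\: S)].

Lemma splitsP H F S : reflect
  {in F, forall e : {set T}, (e \subset S) || (e \subset vertices H :\: S)} (splits H F S).
Proof. by apply: (iffP forall_inP). Qed.

Lemma connected_set_side H F S C x : splits H F S ->
  connected_set (spanning H F) C -> x \in C -> x \in S -> C \subset S.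
Proof.
move=> /splitsP FS /and3P[CV _ /(connectedP CV) cC] xC xS; apply/subsetP => y yC.
apply/idPn => yS; have [e] := cC S x y xC yC xS yS.
rewrite inE => /andP[_ /FS eF] [_ [a [b [ae be aS bS]]]].
case/orP: eF => /subsetP eS; first by rewrite (eS b be) in bS.
by have := eS a ae; rewrite inE aS.
Qed.

(** A component of (V, F) that meets [S] lies in [S] by [connected_set_side], so maximality among
    connected sets within [S] is maximality among all. *)
Lemma components_induced H F S : F \subset edges H -> S \subset vertices H ->
    splits H F S ->
  components (spanning (induced H S) [set e in F | e \subset S]) =
  [set C in components (spanning H F) | C \subset S].
Proof.
move=> FH SV FS; set K := spanning _ _; set L := spanning H F.
have KL C : connected_set K C = connected_set L C && (C \subset S).
  rewrite /connected_set /= (setIidPr SV).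
  have [CS | CS] := boolP (C \subset S); last by rewrite andbF.
  rewrite (subset_trans CS SV) andbT /=; congr (_ && _); apply: eq_connected => /=.
    by rewrite -setIA (setIidPr CS).
  apply/setP => e; rewrite !inE; have [eC | _] := boolP (e \subset C); last by rewrite !andbF.
  by rewrite (subset_trans eC CS) !andbT.
apply/setP => C; rewrite !inE; apply/maxsetP/andP => [[] | [/maxsetP[cC maxC] CS]].
  rewrite KL => /andP[cC CS] maxC; have [C' C'L CC'] := components_sup cC.
  have cC' := components_conn C'L; have /and3P[_ /set0Pn[x xC] _] := cC.
  have C'S : C' \subset S by exact: connected_set_side FS cC' (subsetP CC' x xC) (subsetP CS x xC).
  have <- : C' = C by apply: maxC => //; rewrite KL cC'.
  by move: C'L; rewrite inE.
by split; [rewrite KL cC | move=> B; rewrite KL => /andP[cB _]; apply: maxC].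
Qed.

Lemma sum_splits (R : comPzRingType) (x y : R) H F : F \subset edges H ->
  \sum_(S : {set T} | (S \subset vertices H) && splits H F S)
    x ^+ #|[set C in components (spanning H F) | C \subset S]| *
    y ^+ #|[set C in components (spanning H F) | C \subset vertices H :\: S]|
  = (x + y) ^+ #|components (spanning H F)|.
Proof.
move=> FH; set L := spanning H F; set P := components L.
have /and3P[/eqP covP _ _] : partition P (vertices H) := components_partition L.
have LF : edges L = F by apply/setIidPr.
have coverV (J : {set {set T}}) : J \subset P -> cover J \subset vertices H.
  by move=> JP; rewrite -covP; apply/bigcupsP => C CJ; apply: bigcup_sup (subsetP JP C CJ).
have subJ (J : {set {set T}}) C z : J \subset P -> C \in P -> z \in C -> z \in cover J -> C \in J.
  move=> JP CP zC /bigcupP[B BJ zB].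
  by rewrite (components_eq CP (subsetP JP B BJ) zC zB).
have disJ (J : {set {set T}}) C : J \subset P -> C \in P -> C \notin J ->
    C \subset vertices H :\: cover J.
  move=> JP CP CJ; apply/subsetP => z zC; rewrite inE -covP; apply/andP; split.
    by apply: contra CJ; apply: subJ JP CP zC.
  by apply/bigcupP; exists C.
have neC C : C \in P -> exists z, z \in C.
  by case/components_conn/and3P => _ /set0Pn.
(* The sets [S] that split [F] are the unions of components: [J] is sent to [cover J], and recovered
   as the set of components inside it. *)
rewrite -sum_subsets_exp (reindex_onto cover (fun S => [set C in P | C \subset S])) /=.
  apply: eq_big => J; last first.
    move=> /andP[/andP[_ _] /eqP EJ]; rewrite EJ; congr (_ * _ ^+ _).
    have JP : J \subset P by rewrite -EJ; apply/subsetP => C; rewrite inE => /andP[].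
    rewrite -(setIidPr JP) -cardsD; apply: eq_card => C; rewrite (setIidPr JP) in_setD in_set andbC.
    case CP: (C \in P); rewrite ?andbF ?andbT //.
    apply/idP/idP => [CJ | CJ]; last exact: disJ.
    have [z zC] := neC C CP; apply/negP => CJ'; have := subsetP CJ z zC.
    by rewrite inE => /andP[/bigcupP[]]; exists C.
  apply/andP/idP => [[_ /eqP <-] | JP].
    by apply/subsetP => C; rewrite inE => /andP[].
  rewrite coverV //=; split; last first.
    apply/eqP/setP => C; rewrite inE; apply/andP/idP => [[CP CJ] | CJ].
      by have [z zC] := neC C CP; apply: subJ JP CP zC (subsetP CJ z zC).
    by rewrite (subsetP JP) // bigcup_sup.
  apply/splitsP => e; rewrite -LF => eL; have [C CP eC] := components_sup (conn_edge eL).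
  have [CJ | CJ] := boolP (C \in J); apply/orP; [left | right].
    by apply: subset_trans eC _; apply: bigcup_sup.
  by apply: subset_trans eC _; apply: disJ.
move=> S /andP[SV FS]; apply/eqP; rewrite eqEsubset; apply/andP; split.
  by apply/bigcupsP => C; rewrite inE => /andP[].
apply/subsetP => z zS; have := subsetP SV z zS; rewrite -covP => /bigcupP[C CP zC].
apply/bigcupP; exists C => //; rewrite inE CP.
exact: connected_set_side FS (components_conn CP) zC zS.
Qed.

Lemma rmorph_hpoly (R : pzRingType) (f : {rmorphism {poly int} -> R}) H :
  f (hpoly H) = \sum_(F : {set {set T}} | F \subset edges H)
    (-1) ^+ #|F| * f 'X ^+ #|components (spanning H F)|.
Proof.
rewrite rmorph_sum; apply: eq_bigr => F _.
by rewrite -mul_polyC rmorphM !rmorphXn !rmorphN1.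
Qed.

(** In {poly {poly int}} the outer variable ['X] stands for x and ['X%:P] for y. Both sides are
    expanded over edge sets [F] of [H]; for fixed [F], summing over the sets [S] that split it is
    [sum_splits]. *)
Lemma hpoly_convolution H :
  \sum_(S : {set T} | S \subset vertices H)
    (hpoly (induced H S))^:P * (hpoly (induced H (vertices H :\: S)))%:P
  = poly_XaY (hpoly H).
Proof.
set V := vertices H; pose E S := edges_in (edges H) S.
have dE S : [disjoint E S & E (V :\: S)].
  rewrite -setI_eq0; apply/eqP/setP => e; rewrite !inE.
  apply/andP => -[/andP[eH eS] /andP[_ eVS]]; have [e0 _] := edgesP eH.
  have /set0Pn[z ze] := e0; have := subsetP eVS z ze.
  by rewrite inE (subsetP eS z ze).
have splitE S F : (F \subset E S :|: E (V :\: S)) = (F \subset edges H) && splits H F S.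
  apply/subsetP/andP => [FE | [/subsetP FH /splitsP FS] e eF].
    split; first by apply/subsetP => e /FE /[!inE] /orP[] /andP[].
    by apply/splitsP => e /FE /[!inE] /orP[] /andP[_ ->]; rewrite ?orbT.
  by rewrite !inE FH //=; apply: FS.
pose G S F : {poly {poly int}} := (-1) ^+ #|F| *
  ('X ^+ #|[set C in components (spanning H F) | C \subset S]| *
   'X%:P ^+ #|[set C in components (spanning H F) | C \subset V :\: S]|).
transitivity (\sum_(S : {set T} | S \subset V)
    \sum_(F : {set {set T}} | F \subset E S :|: E (V :\: S)) G S F).
  apply: eq_bigr => S SV; rewrite sum_subsetU // !rmorph_hpoly mulr_suml.
  apply: eq_bigr => F1 F1S; rewrite mulr_sumr; apply: eq_bigr => F2 F2S.
  have F12 : F1 :|: F2 \subset E S :|: E (V :\: S) by apply: setUSS.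
  have:= F12; rewrite splitE => /andP[FH FS].
  have F1E : [set e in F1 :|: F2 | e \subset S] = F1.
    apply/setP => e; rewrite !inE; apply/andP/idP => [[/orP[//|eF2] eS] | eF1].
      have eE : e \in E (V :\: S) := subsetP F2S e eF2.
      have := disjointFl (dE S) eE; rewrite inE eS andbT.
      by move: eE; rewrite inE => /andP[->].
    by have := subsetP F1S e eF1; rewrite inE eF1 => /andP[_ ->].
  have F2E : [set e in F1 :|: F2 | e \subset V :\: S] = F2.
    apply/setP => e; rewrite !inE; apply/andP/idP => [[/orP[eF1|//] eS] | eF2].
      have eE : e \in E S := subsetP F1S e eF1.
      have := disjointFr (dE S) eE; rewrite inE eS andbT.
      by move: eE; rewrite inE => /andP[->].
    by have := subsetP F2S e eF2; rewrite inE eF2 orbT => /andP[_ ->].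
  have SS : V :\: (V :\: S) = S by rewrite setDDr setDv set0U (setIidPr SV).
  have FS' : splits H (F1 :|: F2) (V :\: S).
    by apply/splitsP => e /(splitsP _ _ _ FS); rewrite -/V SS orbC.
  have cF : #|F1 :|: F2| = (#|F1| + #|F2|)%N.
    apply/eqP; rewrite (leq_card_setU _ _).2.
    exact: disjointWl F1S (disjointWr F2S (dE S)).
  rewrite /G -(components_induced FH SV FS) -(components_induced FH (subsetDl _ _) FS').
  by rewrite F1E F2E cF exprD /= map_polyX -!mulrA; congr (_ * _); rewrite mulrCA.
rewrite (exchange_big_dep (fun F => F \subset edges H)) /=; last first.
  by move=> S F _; rewrite splitE => /andP[].
rewrite [RHS](rmorph_hpoly (comp_poly ('X + 'X%:P) \o map_poly polyC)).
apply: eq_bigr => F FH; rewrite /G -mulr_sumr; congr (_ * _).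
rewrite /= map_polyX comp_polyX -(sum_splits _ _ FH); apply: eq_bigl => S.
by rewrite splitE FH.
Qed.

(** The empty edge set contributes the leading monomial; any other contains an edge with two points,
    which leaves fewer components than vertices. *)
Lemma size_hpoly_monic H : {in edges H, forall e : {set T}, (1 < #|e|)%N} ->
  hpoly H \is monic /\ size (hpoly H) = #|vertices H|.+1.
Proof.
move=> E1; rewrite /hpoly (bigD1 set0) ?sub0set //=.
rewrite cards0 expr0 scale1r card_components_spanning0.
set p := \sum_(_ | _) _.
have sp : (size p < size ('X^#|vertices H| : {poly int}))%N.
  rewrite size_polyXn; apply: leq_trans (size_sum _ _ _) _.
  apply/bigmax_leqP => F /andP[FH /set0Pn[e eF]].
  apply: leq_trans (size_scale_leq _ _) _; rewrite size_polyXn.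
  have eH := subsetP FH e eF; apply: (@card_components_lt (spanning H F) e) (E1 e eH).
  by rewrite inE eH.
by rewrite size_polyDl // size_polyXn monicE lead_coefDl // lead_coefXn eqxx.
Qed.

Lemma hpoly_no_vertex H : vertices H = set0 -> hpoly H = 1.
Proof.
move=> V0; have E0 : edges H = set0.
  apply/setP => e; rewrite inE; apply/negP => /edgesP[e0].
  by rewrite V0 subset0 (negPf e0).
rewrite /hpoly E0 (big_pred1 set0) => [|F]; last by rewrite subset0.
by rewrite cards0 card_components_spanning0 V0 cards0 expr0 scale1r.
Qed.

(** The coefficient selects the edge sets with a single component, that is, those joining every
    vertex of [S] to [v]. *)
Lemma coef1_hpoly_induced (R : realFieldType) H S v : S \subset vertices H -> v \in S ->
  ((hpoly (induced H S))`_1)%:~R = rooted_sum R (edges H) [set v] S.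
Proof.
move=> SV vS; have VS : vertices (induced H S) = S by apply/setIidPr.
rewrite /hpoly coef_sum rmorph_sum /rooted_sum [RHS]big_mkcondr.
apply: eq_bigr => F FE; rewrite coefZ coefXn rmorphM rmorphXn rmorphN1.
have EF : edges (spanning (induced H S) F) = F by apply/setIidPr.
have VF : vertices (spanning (induced H S) F) = S by [].
rewrite eq_sym card_components_eq1 VF (connected_rooted (v := v)) ?VF // EF.
have -> : S != set0 by apply/set0Pn; exists v.
by case: (rooted _ _ _); rewrite ?mulr1 ?mulr0.
Qed.

End Components.

Theorem theorem8 (R : realType) (T : finType) (H : hypergraph T) (t D : nat)
    (t_ge2 : (2 <= t)%N) (H_uniform : uniform t H)
    (H_degree : forall v, v \in vertices H -> (degree H v <= D)%N) :
  [/\ hpoly H \is monic /\ size (hpoly H) = #|vertices H|.+1,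
      forall K : hypergraph T, vertices K = set0 -> hpoly K = 1,
      \sum_(S : {set T} | S \subset vertices H)
          (hpoly (induced H S))^:P * (hpoly (induced H (vertices H :\: S)))%:P
        = poly_XaY (hpoly H)
    & forall (v : T) (s : nat), v \in vertices H -> (1 <= s)%N ->
      \sum_(S : {set T} | [&& S \subset vertices H, v \in S & #|S| == s])
          `|(hpoly (induced H S))`_1|%:~R
        <= (expR 1 * t%:R * D%:R) ^+ (s - 1) :> R].
Proof.
split; [|exact: hpoly_no_vertex|exact: hpoly_convolution|].
  by apply: size_hpoly_monic => e /H_uniform ->.
move=> v [//|s] vH _; rewrite subn1 /=.
have d0 : 0 <= t%:R * D%:R :> R by rewrite mulr_ge0.
have Hd : {in vertices H, forall v, \sum_(w in vertices H :\ v)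
    (codegree (edges H) v w)%:R <= t%:R * D%:R :> R}.
  move=> u uH; rewrite -natr_sum -natrM ler_nat.
  by apply: leq_trans (sum_codegree_le _ _ H_uniform) _; rewrite leq_mul2l H_degree ?orbT.
have vV : [set v] \subset vertices H by rewrite sub1set.
(* Here [d] is tD and the only root is [v]; [s] now counts the vertices of [S] other than [v], so it
   is the exponent of the claim. *)
have := level_sum_le s d0 Hd vV; rewrite cards1 -mulrA.
have fb := ler_wpM2l (exprn_ge0 s d0) (forest_bound1_le R s).
move/le_trans/(_ fb); rewrite -exprMn [_ * expR 1]mulrC mulrA.
apply: le_trans; rewrite le_eqVlt; apply/orP; left; apply/eqP.
rewrite /level_sum cards1 add1n; apply: eq_big => S.
  by rewrite sub1set andbCA.
case/and3P => SV vS _; rewrite -(coef1_hpoly_induced R SV vS).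
by rewrite intr_norm.
Qed.
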